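(* Let $n\ge 6$. Among all unicyclic graphs with $n$ vertices whose unique cycle has length $4$, $$F(G_{4,1}^{(n)}) > F(G_{4,2}^{(n)}) = F(G_{4,3}^{(n)}) > F(G_{4,1}^{'(n)}),$$ and every such graph not isomorphic to one of these four has F-index less than $F(G_{4,1}^{'(n)})$.
   Context: All graphs are finite and simple. The F-index of a graph $G$ is $F(G)=\sum_{v\in V(G)} d_G(v)^3$. A unicyclic graph is a connected graph with exactly one cycle. Attaching a leaf to a vertex means adding a new vertex adjacent only to it. $G_{4,1}^{(m)}$: the cycle $C_4$ with $m-4$ leaves attached to one cycle vertex. $G_{4,2}^{(n)}$: $C_4$ with $n-5$ leaves attached to a cycle vertex $u$ and one leaf attached to a cycle vertex adjacent to $u$. $G_{4,3}^{(n)}$: $C_4$ with $n-5$ leaves attached to a cycle vertex $u$ and one leaf attached to the cycle vertex at distance $2$ from $u$. $G_{4,1}^{'(n)}$: obtained from $G_{4,1}^{(n-1)}$ by attaching a new leaf to one of its leaves. *)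

(* Defs.v *)
From mathcomp Require Import all_boot.
Set Implicit Arguments.
Unset Strict Implicit.
Unset Printing Implicit Defensive.

Record sgraph := SGraph {
  vertex :> finType;
  adj : rel vertex;
  adj_sym : symmetric adj;
  adj_irrefl : irreflexive adj }.

Definition deg (G : sgraph) (x : G) : nat := #|[set y | adj x y]|.

Definition F_index (G : sgraph) : nat := \sum_(x : G) deg x ^ 3.

Definition isomorphic (G H : sgraph) : Prop :=
  exists2 f : G -> H, bijective f & forall x y, adj (f x) (f y) = adj x y.

Definition connected (G : sgraph) : Prop := forall x y : G, connect (@adj G) x y.

(* A cycle of a graph is listed as the sequence of its vertices, so the same
   cycle has several listings (rotations and reversals).  Two listings denote
   the same cycle exactly when they have the same set of edges. *)
Definition graph_cycle (G : sgraph) (c : seq G) : bool :=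
  [&& 2 < size c, uniq c & cycle (@adj G) c].

Definition cycle_edges (G : sgraph) (c : seq G) : {set {set G}} :=
  [set [set x; next c x] | x in c].

Definition unicyclic (G : sgraph) : Prop :=
  connected G /\
  exists2 c : seq G, graph_cycle c
    & forall c' : seq G, graph_cycle c' -> cycle_edges c' = cycle_edges c.

Definition unicyclic4 (n : nat) (G : sgraph) : Prop :=
  [/\ #|G| = n, unicyclic G & forall c : seq G, graph_cycle c -> size c = 4].

Section AddLeaves.
Variables (G : sgraph) (v : G) (k : nat).

Definition add_leaves_adj (x y : G + 'I_k) : bool :=
  match x, y with
  | inl a, inl b => adj a b
  | inl a, inr _ => a == v
  | inr _, inl b => b == v
  | inr _, inr _ => false
  end.

Lemma add_leaves_sym : symmetric add_leaves_adj.
Proof. by move=> [a|i] [b|j] //=; rewrite adj_sym. Qed.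

Lemma add_leaves_irrefl : irreflexive add_leaves_adj.
Proof. by move=> [a|i] //=; rewrite adj_irrefl. Qed.

Definition add_leaves : sgraph := SGraph add_leaves_sym add_leaves_irrefl.

End AddLeaves.

(* [ordS] is the cyclic successor on ['I_4]. *)
Definition C4_adj : rel 'I_4 := fun i j => (j == ordS i) || (i == ordS j).

Lemma C4_sym : symmetric C4_adj.
Proof. by move=> i j; rewrite /C4_adj orbC. Qed.

Lemma C4_irrefl : irreflexive C4_adj.
Proof. by case=> [[|[|[|[|]]]] ?]. Qed.

Definition C4 : sgraph := SGraph C4_sym C4_irrefl.

Definition c4_0 : C4 := ord0.
Definition c4_1 : C4 := ordS c4_0.
Definition c4_2 : C4 := ordS c4_1.

Definition G41 (m : nat) : sgraph := add_leaves c4_0 (m - 4).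

Definition G42 (n : nat) : sgraph :=
  @add_leaves (add_leaves c4_0 (n - 5)) (inl c4_1) 1.

Definition G43 (n : nat) : sgraph :=
  @add_leaves (add_leaves c4_0 (n - 5)) (inl c4_2) 1.

Lemma G41_pred_has_leaf (n : nat) : 6 <= n -> 0 < n.-1 - 4.
Proof. by case: n => // n; rewrite subn_gt0. Qed.

(* The leaf that receives the new leaf exists only for [6 <= n]; all leaves of
   [G41 n.-1] are equivalent under automorphisms, the first one is used. *)
Definition G41' (n : nat) (hn : 6 <= n) : sgraph :=
  @add_leaves (G41 n.-1) (inr (Ordinal (G41_pred_has_leaf hn))) 1.

(* Main.v *)
(* Let [c] be the 4-cycle and let the excess of a vertex be its degree minus 2
   on [c], minus 1 off [c].  Removing an edge of [c] leaves an acyclic graph, so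
   the degrees sum to at most 2n and the excesses to at most M = n - 4.  If all
   degrees are at most M, then deg^3 exceeds its minimal value (8 or 1) by at
   most (M^2 + 2M + 4) times the excess, and summing over the vertices gives the
   strict bound.  Otherwise some vertex [v] has degree at least n - 3; it lies on
   [c] and uses up all of the excess but at most one unit, so the graph is [c]
   with leaves attached to [v], plus at most one further pendant vertex [w]
   whose only neighbour [q] takes the remaining unit. *)

Require Import Defs.
From mathcomp Require Import all_boot perm.
From mathcomp Require Import zify.
Set Implicit Arguments.
Unset Strict Implicit.
Unset Printing Implicit Defensive.

(** * Cycles and degree sums of acyclic relations *)

(** If they agreed, two applications of [next] would return to [x]; in the listing rotated to start
    [x, y, z] they lead to [z]. *)
Lemma next_neq_prev (T : eqType) (c : seq T) (x : T) :
  2 < size c -> uniq c -> x \in c -> next c x != prev c x.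
Proof.
move=> sz_c uniq_c x_c; have [i s def_c] := rot_to x_c.
apply: contraTneq isT => eq_np.
have: next c (next c x) = x by rewrite eq_np next_prev.
rewrite -!(next_rot i uniq_c).
move: uniq_c sz_c; rewrite -(rot_uniq i) -(size_rot i) def_c.
case: s {def_c} => [|y [|z s]] // /andP[] /=; rewrite !inE !negb_or.
move=> /and3P[neq_xy neq_xz _] _ _; rewrite !eqxx.
rewrite eq_sym in neq_xy; rewrite (negPf neq_xy) ?eqxx.
by move=> zx; rewrite -zx eqxx in neq_xz.
Qed.

Lemma cycle_of_min_degree2 (T : finType) (e : rel T) (S : {set T}) :
    symmetric e -> irreflexive e -> S != set0 ->
    (forall x, x \in S -> 1 < #|[set y in S | e x y]|) ->
  exists c : seq T, [/\ 2 < size c, uniq c & cycle e c].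
Proof.
move=> e_sym e_irr /set0Pn[x0 Sx0] degS.
(* A longest simple path [x :: p]: its end [x] has two neighbours, both in [p]. *)
pose P m := [exists t : m.-tuple T, [&& uniq t, sorted e t & all (mem S) t]].
have P1: exists m, P m.
  by exists 1; apply/existsP; exists [tuple x0]; rewrite /= Sx0.
have leP: forall m, P m -> m <= #|T|.
  move=> m /existsP[t /and3P[uniq_t _ _]].
  by rewrite -(size_tuple t) -(card_uniqP uniq_t) max_card.
case: (ex_maxnP P1 leP) => m /existsP[t /and3P[]].
move: (size_tuple t); case: (tval t) => [<- _ _ _ max_m|x p sz_p uniq_p path_p].
  have: P 1 by apply/existsP; exists [tuple x0]; rewrite /= Sx0.
  by move/max_m.
move=> /= /andP[Sx Sp] max_m.
have nbr_in y : y \in S -> e x y -> y \in p.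
  move=> Sy exy; apply: contraT => yNp.
  suff /max_m: P m.+1 by rewrite ltnn.
  have szy: size (y :: x :: p) == m.+1 by rewrite -sz_p.
  apply/existsP; exists (Tuple szy).
  rewrite /= inE negb_or yNp andbT /= Sy Sx Sp [e y x]e_sym exy [path e x p]path_p.
  rewrite /= in uniq_p; rewrite uniq_p !andbT.
  by apply: contraTneq exy => ->; rewrite e_irr.
have /card_gt1P[y [z []]] := degS _ Sx.
rewrite !inE => /andP[Sy exy] /andP[Sz exz] neq_yz.
(* Of the two neighbours take the one farther along [p]: the path up to it has at least two
   vertices, so with [x] it closes to a cycle of length at least 3. *)
wlog lt_yz: y z Sy exy Sz exz neq_yz / index y p < index z p.
  move=> IH; case: (ltngtP (index y p) (index z p)); first exact: IH.
    by apply: IH; rewrite // eq_sym.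
  move/(congr1 (nth x p)); rewrite !nth_index ?nbr_in // => /eqP.
  by rewrite (negPf neq_yz).
have zp := nbr_in _ Sz exz.
have lt_z: index z p < size p by rewrite index_mem.
exists (x :: take (index z p).+1 p); split.
- rewrite /= size_take_min (minn_idPl lt_z) !ltnS.
  exact: leq_ltn_trans (leq0n _) lt_yz.
- move: uniq_p => /= /andP[xp up]; rewrite take_uniq // andbT.
  by apply: contra xp => /mem_take.
- rewrite /= rcons_path take_path //= (take_nth z) // last_rcons nth_index //.
  by rewrite e_sym.
Qed.

(** A forest has at most [#|S| - 1] edges. Induction on [#|S|]: some vertex has degree at most 1,
    and removing it lowers the sum by twice its degree. *)
Lemma acyclic_sum_degrees (T : finType) (e : rel T) (S : {set T}) :
    symmetric e -> irreflexive e ->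
    (forall c : seq T, 2 < size c -> uniq c -> ~~ cycle e c) -> S != set0 ->
  \sum_(x in S) #|[set y in S | e x y]| + 2 <= #|S|.*2.
Proof.
move=> e_sym e_irr acyc.
move: {2}#|S| (erefl #|S|) => m; elim: m S => [|m IH] S cardS S0.
  by rewrite -card_gt0 cardS in S0.
have [x Sx deg_x]: exists2 x, x \in S & #|[set y in S | e x y]| <= 1.
  apply/exists_inP; apply: contraT; rewrite negb_exists_in => /forall_inP big.
  have [|c [sz_c uc]] := cycle_of_min_degree2 e_sym e_irr S0.
    by move=> x /big; rewrite -ltnNge.
  by move/negP: (acyc c sz_c uc).
have cardSx: #|S :\ x| = m by move: cardS; rewrite (cardsD1 x) Sx => -[].
have split_deg y : y \in S -> 
    #|[set z in S | e y z]| = #|[set z in S :\ x | e y z]| + e x y.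
  move=> Sy; rewrite (cardsD1 x) inE Sx e_sym addnC; congr (_ + _).
  by apply: eq_card => z; rewrite !inE andbA.
have degE: \sum_(y in S :\ x) (e x y : nat) = #|[set z in S | e x z]|.
  rewrite -sum1dep_card big_mkcondr [RHS](big_setD1 x) //= e_irr add0n.
  by apply: eq_bigr => y _; case: (e x y).
rewrite (big_setD1 x) //=.
rewrite (eq_bigr (fun y => #|[set z in S :\ x | e y z]| + e x y)); last first.
  by move=> y /setD1P[_ Sy]; exact: split_deg.
rewrite big_split /= degE.
(* The induction hypothesis needs a nonempty set; a lone vertex has degree 0. *)
have [Sx0|Sx0] := eqVneq (S :\ x) set0.
  have : #|[set z in S | e x z]| = 0.
    by rewrite -degE Sx0 big_set0.
  by rewrite Sx0 big_set0 cardS => ->; lia.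
by have := IH _ cardSx Sx0; rewrite cardS cardSx; lia.
Qed.

(** * Degrees and excesses in unicyclic graphs *)

Lemma deg_gt0 (G : sgraph) (x y : G) : adj x y -> 0 < deg x.
Proof. by move=> xy; apply/card_gt0P; exists y; rewrite inE. Qed.

Lemma deg1_adj (G : sgraph) (x p : G) :
  deg x <= 1 -> adj x p -> forall y, adj x y = (y == p).
Proof.
move=> deg_x xp y; apply/idP/eqP=> [xy|->//].
by apply: (card_le1_eqP deg_x); rewrite inE.
Qed.

Lemma graph_cycle_nbrs (G : sgraph) (c : seq G) (x : G) :
    graph_cycle c -> x \in c ->
  [/\ adj x (next c x), adj x (prev c x) & next c x != prev c x].
Proof.
move=> /and3P[sz_c uc cc] xc; split; first exact: next_cycle.
  by rewrite adj_sym prev_cycle.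
exact: next_neq_prev.
Qed.

Lemma graph_cycle_deg (G : sgraph) (c : seq G) (x : G) :
  graph_cycle c -> x \in c -> 1 < deg x.
Proof.
move=> gc xc; have [xn xp np] := graph_cycle_nbrs gc xc.
by apply/card_gt1P; exists (next c x), (prev c x); rewrite !inE.
Qed.

Lemma unicyclic_sum_deg (G : sgraph) :
  unicyclic G -> \sum_(x : G) deg x <= #|G|.*2.
Proof.
move=> [_ [c gc edges_c]]; have /and3P[sz_c _ _] := gc.
have [a ac]: exists a, a \in c.
  by case: c sz_c {gc edges_c} => // a; exists a; rewrite mem_head.
(* [E] lies on every cycle, so deleting it leaves an acyclic relation. *)
set E := [set a; next c a].
pose e x y := @adj G x y && ([set x; y] != E).
have e_sym: symmetric e by move=> x y; rewrite /e adj_sym setUC.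
have e_irr: irreflexive e by move=> x; rewrite /e adj_irrefl.
have acyc c' : 2 < size c' -> uniq c' -> ~~ cycle e c'.
  move=> sz' u'; apply/negP=> cyc.
  have gc': graph_cycle c'.
    by rewrite /graph_cycle sz' u' /=; apply: sub_cycle cyc => x y /andP[].
  have: E \in cycle_edges c' by rewrite (edges_c _ gc'); apply: imset_f.
  case/imsetP=> x xc' defE.
  by have := next_cycle cyc xc'; rewrite /e -defE eqxx andbF.
have T0: [set: G] != set0 by apply/set0Pn; exists a; rewrite inE.
have := acyclic_sum_degrees e_sym e_irr acyc T0.
rewrite cardsT; apply: leq_trans.
(* Restoring [E] adds at most one to the degree of each of its two ends, which is exactly the slack
   [+ 2] in the forest bound. *)
have cardE: \sum_(x : G) (x \in E) <= 2.
  have ->: \sum_(x : G) (x \in E) = #|E|.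
    by rewrite -sum1_card [RHS]big_mkcond; apply: eq_bigr => x _; case: (x \in E).
  by rewrite /E cards2; case: eqP.
apply: leq_trans (leq_add (leqnn _) cardE).
rewrite [X in _ <= X + _](eq_bigl xpredT) => [|x]; last by rewrite inE.
rewrite -big_split; apply: leq_sum => x _ /=.
rewrite /deg -(cardsID [set y | [set x; y] == E]) addnC leq_add //.
  by apply: subset_leq_card; apply/subsetP=> y; rewrite !inE /e => /andP[-> ->].
case xE: (x \in E); last first.
  rewrite leqn0 cards_eq0; apply/set0Pn=> -[y]; rewrite !inE => /andP[_ /eqP E'].
  by move: xE; rewrite -E' set21.
apply/card_le1_eqP => y z; rewrite !inE => /andP[xy /eqP Ey] /andP[xz /eqP Ez].
have: y \in [set x; z] by rewrite Ez -Ey set22.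
rewrite !inE => /orP[/eqP yx|/eqP //].
by rewrite yx adj_irrefl in xy.
Qed.

Lemma connected_deg_gt0 (G : sgraph) (x : G) :
  connected G -> 1 < #|G| -> 0 < deg x.
Proof.
move=> conn_G /card_gt1P[a [b [_ _ neq_ab]]].
have [y neq_xy]: exists y, x != y.
  by have [->|] := eqVneq x a; [exists b | exists a].
have /connectP[[|z p] /=] := conn_G x y.
  by move=> _ yx; rewrite yx eqxx in neq_xy.
by case/andP=> /deg_gt0.
Qed.

Definition excess (G : sgraph) (c : seq G) (x : G) : nat :=
  deg x - (1 + (x \in c)).

(** The subtraction in [excess] never truncates: vertices of [c] have two cycle neighbours, and the
    others have a neighbour by connectedness. *)
Lemma deg_excess (G : sgraph) (c : seq G) (x : G) :
  connected G -> graph_cycle c -> deg x = 1 + (x \in c) + excess c x.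
Proof.
move=> conn_G gc; rewrite /excess subnKC //.
have [xc|_] := boolP (x \in c); first exact: graph_cycle_deg gc xc.
apply: connected_deg_gt0 => //; have /and3P[sz_c uc _] := gc.
by rewrite (leq_trans _ (max_card (mem c))) // (card_uniqP uc) (ltn_trans _ sz_c).
Qed.

Lemma sum1T (T : finType) : \sum_(x : T) 1 = #|T|.
Proof. by rewrite sum1_card. Qed.

Lemma sum_mem_uniq (T : finType) (c : seq T) :
  uniq c -> \sum_(x : T) (x \in c) = size c.
Proof.
move=> /card_uniqP <-; rewrite -sum1_card [RHS]big_mkcond.
by apply: eq_bigr => x _; case: (x \in c).
Qed.

Lemma unicyclic_sum_excess (G : sgraph) (c : seq G) :
  unicyclic G -> graph_cycle c -> \sum_(x : G) excess c x <= #|G| - size c.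
Proof.
move=> uG gc; have /and3P[_ uc _] := gc; have [conn_G _] := uG.
have := unicyclic_sum_deg uG.
rewrite (eq_bigr _ (fun x _ => deg_excess x conn_G gc)) !big_split /=.
rewrite sum1T (sum_mem_uniq uc); set m := #|G|; lia.
Qed.

Lemma excess_budget2 (G : sgraph) (c : seq G) (v x : G) :
    unicyclic G -> graph_cycle c -> v != x ->
  excess c v + excess c x <= #|G| - size c.
Proof.
move=> uG gc vx; apply: leq_trans (unicyclic_sum_excess uG gc).
by rewrite (bigD1 v) //= (bigD1 x) 1?eq_sym //=; lia.
Qed.

Lemma excess_budget (G : sgraph) (c : seq G) (v x y : G) :
    unicyclic G -> graph_cycle c -> v != x -> v != y -> x != y ->
  excess c v + excess c x + excess c y <= #|G| - size c.
Proof.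
move=> uG gc vx vy xy; apply: leq_trans (unicyclic_sum_excess uG gc).
rewrite (bigD1 v) //= (bigD1 x) 1?eq_sym //= (bigD1 y) /=; last first.
  by rewrite [y == v]eq_sym [y == x]eq_sym vy xy.
lia.
Qed.

Lemma small_degrees_F_index (G : sgraph) (c : seq G) (n : nat) :
    #|G| = n -> unicyclic G -> graph_cycle c -> size c = 4 -> 6 <= n ->
    (forall x : G, deg x <= n - 4) ->
  F_index G < (n - 3) ^ 3 + n + 27.
Proof.
move=> cardG uG gc szc hn deg_small; have [conn_G _] := uG.
have /and3P[_ uc _] := gc.
(* [d ^ 3 - 8 = (d - 2)(d ^ 2 + 2 d + 4)], and [d <= M]. *)
set M := n - 4; pose K := M ^ 2 + 2 * M + 4.
(* Off the cycle [d ^ 3 - 1 = (d - 1)(d ^ 2 + d + 1)], whose second factor is also at most [K]. The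
   base value on the cycle is [1 + 7 = 2 ^ 3]. *)
have bound x : deg x ^ 3 <= 1 + 7 * (x \in c) + K * excess c x.
  have := deg_small x; rewrite (deg_excess x conn_G gc) -/M /K.
  move: (excess c x) => h; case: (x \in c) => /=; nia.
have: F_index G <= n + 28 + K * M.
  apply: leq_trans (leq_sum _ (fun x _ => bound x)) _.
  rewrite 2!big_split /= -!big_distrr /= sum1T (sum_mem_uniq uc) szc cardG.
  rewrite leq_add2l leq_mul2l; apply/orP; right.
  by have := unicyclic_sum_excess uG gc; rewrite cardG szc.
have ->: n - 3 = M.+1 by rewrite /M; lia.
(* The target exceeds the bound [n + 28 + K * M] by [M ^ 2 - M], which is positive for [M > 1]. *)
have: 1 < M by rewrite /M; lia.
rewrite /K !expnS expn0; nia.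
Qed.

(** * The F-index of graphs built by attaching leaves *)

Lemma deg_sum (G : sgraph) (x : G) : deg x = \sum_(y : G) adj x y.
Proof.
rewrite /deg -sum1dep_card big_mkcond.
by apply: eq_bigr => y _; case: (adj x y).
Qed.

Lemma deg_inl (G : sgraph) (v : G) (k : nat) (x : G) :
  deg (inl x : add_leaves v k) = deg x + k * (x == v).
Proof.
rewrite !deg_sum big_sumType /=; congr (_ + _).
by rewrite sum_nat_const card_ord.
Qed.

Lemma deg_inr (G : sgraph) (v : G) (k : nat) (i : 'I_k) :
  deg (inr i : add_leaves v k) = 1.
Proof.
rewrite deg_sum big_sumType /= [X in _ + X]big1 // addn0.
by rewrite (bigD1 v) //= eqxx big1 // => y /negPf ->.
Qed.

(** Among old vertices only [v] changes degree, and each leaf contributes 1. The old cube stands on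
    the left to avoid truncated subtraction. *)
Lemma F_index_add_leaves (G : sgraph) (v : G) (k : nat) :
  F_index (add_leaves v k) + deg v ^ 3 = F_index G + (deg v + k) ^ 3 + k.
Proof.
rewrite /F_index big_sumType /=.
rewrite [X in _ + X + _](eq_bigr (fun=> 1)) => [|i _]; last by rewrite deg_inr.
rewrite sum1T card_ord (bigD1 v) //= [in RHS](bigD1 v) //= deg_inl eqxx muln1.
rewrite (eq_bigr (fun x : G => deg x ^ 3)) => [|x /negPf neq_xv]; first by lia.
by rewrite deg_inl neq_xv muln0 addn0.
Qed.

Lemma card_add_leaves (G : sgraph) (v : G) (k : nat) :
  #|add_leaves v k| = #|G| + k.
Proof. by rewrite card_sum card_ord. Qed.

Lemma deg_C4 (x : C4) : deg x = 2.
Proof.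
by rewrite deg_sum !big_ord_recl big_ord0; case: x => [[|[|[|[|]]]] ?].
Qed.

Lemma F_index_C4 : F_index C4 = 32.
Proof. by rewrite /F_index !big_ord_recl big_ord0 !deg_C4. Qed.

Lemma F_index_G41 (n : nat) :
  4 <= n -> F_index (G41 n) = (n - 2) ^ 3 + n + 20.
Proof.
move=> hn; have := F_index_add_leaves c4_0 (n - 4).
rewrite deg_C4 F_index_C4 (_ : 2 + (n - 4) = n - 2); [rewrite /G41|]; lia.
Qed.

(** Treats [G42] and [G43] at once: every cycle vertex other than [c4_0] has degree 2 before the
    pendant is attached, so its position is irrelevant. *)
Lemma F_index_C4_leaves_pendant (n : nat) (x : C4) :
    5 <= n -> x != c4_0 ->
  F_index (@add_leaves (add_leaves c4_0 (n - 5)) (inl x) 1)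
    = (n - 3) ^ 3 + n + 39.
Proof.
move=> hn /negPf x0; have := F_index_add_leaves (inl x : add_leaves c4_0 (n - 5)) 1.
have := F_index_add_leaves c4_0 (n - 5).
rewrite deg_inl x0 deg_C4 F_index_C4 (_ : 2 + (n - 5) = n - 3); last by lia.
by rewrite muln0 (deg_C4 x); lia.
Qed.

Lemma F_index_G41' (n : nat) (hn : 6 <= n) :
  F_index (G41' hn) = (n - 3) ^ 3 + n + 27.
Proof.
have := F_index_add_leaves (inr (Ordinal (G41_pred_has_leaf hn)) : G41 n.-1) 1.
have le4n: 4 <= n.-1 by lia.
rewrite /G41' deg_inr (F_index_G41 le4n) (_ : n.-1 - 2 = n - 3); lia.
Qed.

(** * Unicyclicity of [C4] and its preservation under attaching leaves *)

Lemma connected_add_leaves (G : sgraph) (v : G) (k : nat) :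
  connected G -> connected (add_leaves v k).
Proof.
move=> conn_G; have to_v x : connect (@adj (add_leaves v k)) x (inl v).
  case: x => [x|i]; last by apply: connect1; rewrite /= eqxx.
  have /connectP[p] := conn_G x v; elim: p x => [|y p IH] x /=.
    by move=> _ ->; exact: connect0.
  move=> /andP[xy py] lst; apply: connect_trans (IH y py lst).
  exact: connect1.
move=> x y; apply: connect_trans (to_v x) _.
by rewrite (sym_connect_sym (@adj_sym (add_leaves v k))).
Qed.

(** A new leaf has degree 1 and cycle vertices have degree at least 2, so no cycle meets a new
    leaf. *)
Lemma add_leaves_cycleP (G : sgraph) (v : G) (k : nat) (c : seq (add_leaves v k)) :
  graph_cycle c -> exists2 c0 : seq G, graph_cycle c0 & c = map inl c0.
Proof.
move=> gc; have [c0 def_c]: exists c0 : seq G, c = map inl c0.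
  have: all (fun x => if x is inl _ then true else false) c.
    apply/allP=> -[x|i] // /(graph_cycle_deg gc).
    by rewrite deg_inr.
  elim: (c) => [|[x|i] s IH] //=; first by exists [::].
  by move=> /IH[c0 ->]; exists (x :: c0).
exists c0 => //; move: gc; rewrite def_c /graph_cycle size_map.
rewrite map_inj_uniq => [/and3P[-> -> /=]|x y [] //].
by rewrite cycle_map.
Qed.

Lemma graph_cycle_map_inl (G : sgraph) (v : G) (k : nat) (c : seq G) :
  graph_cycle c -> graph_cycle (map inl c : seq (add_leaves v k)).
Proof.
rewrite /graph_cycle size_map map_inj_uniq => [/and3P[-> -> /=]|x y [] //].
by rewrite cycle_map.
Qed.

(** The new edge set depends on [c] only through the old one, so uniqueness of the cycle is
    inherited. *)
Lemma cycle_edges_map_inl (G : sgraph) (v : G) (k : nat) (c : seq G) :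
    uniq c ->
  cycle_edges (map inl c : seq (add_leaves v k))
    = [set [set (inl x : add_leaves v k) | x in (E : {set G})] | E in cycle_edges c].
Proof.
move=> uc; apply/setP=> E.
have inl_inj: injective (inl : G -> add_leaves v k) by move=> x y [].
apply/imsetP/imsetP=> [[_ /mapP[x xc ->] ->]|[_ /imsetP[x xc ->] ->]].
  exists [set x; next c x]; first exact: imset_f.
  by rewrite (next_map inl_inj uc) imsetU1 imset_set1.
exists (inl x); first exact: map_f.
by rewrite (next_map inl_inj uc) imsetU1 imset_set1.
Qed.

Lemma unicyclic4_add_leaves (n : nat) (G : sgraph) (v : G) (k : nat) :
  unicyclic4 n G -> unicyclic4 (n + k) (add_leaves v k).
Proof.
case=> cardG [conn_G [c gc edges_c]] size4; split.
- by rewrite card_add_leaves cardG.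
- split; first exact: connected_add_leaves.
  exists (map inl c); first exact: graph_cycle_map_inl.
  move=> _ /add_leaves_cycleP[c0 gc0 ->].
  have [/and3P[_ uc _] /and3P[_ uc0 _]] := (gc, gc0).
  by rewrite !cycle_edges_map_inl // edges_c.
- by move=> _ /add_leaves_cycleP[c0 /size4 sz ->]; rewrite size_map.
Qed.

Lemma C4_adjE (x y : C4) : adj x y = (y == ordS x) || (y == ord_pred x).
Proof.
by rewrite /= /C4_adj -(can2_eq (@ordSK 4) (@ord_predK 4)) [ordS y == x]eq_sym.
Qed.

(** Each vertex of [C4] has just two neighbours, and the distinct successor and predecessor on [c]
    exhaust them. *)
Lemma C4_cycle_next (c : seq C4) (x : C4) : graph_cycle c -> x \in c ->
  [set next c x; prev c x] = [set ordS x; ord_pred x].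
Proof.
move=> gc xc; have [] := graph_cycle_nbrs gc xc; rewrite !C4_adjE.
case/orP=> /eqP-> /orP[] /eqP->; rewrite ?eqxx // => _.
by rewrite setUC.
Qed.

Lemma C4_cycle_full (c : seq C4) (x : C4) : graph_cycle c -> x \in c.
Proof.
(* On [C4] the two cycle neighbours of [y] are all its neighbours. *)
move=> gc; have closed y : y \in c -> ordS y \in c.
  move=> yc; have := set21 (ordS y) (ord_pred y).
  rewrite -(C4_cycle_next gc yc) !inE.
  by case/orP=> /eqP->; rewrite ?mem_next ?mem_prev.
have [y yc]: exists y, y \in c.
  by case: (c) (and3P gc) => [[]//|y s _]; exists y; rewrite mem_head.
have: x \in [:: y; ordS y; ordS (ordS y); ordS (ordS (ordS y))].
  by case: x => [[|[|[|[|]]]] ?]; case: y {yc} => [[|[|[|[|]]]] ?].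

by rewrite !inE => /or4P[] /eqP->; rewrite ?closed.
Qed.

(** The right side does not mention [c], which gives uniqueness of the cycle. The two cases in the
    proof are the two directions of traversal. *)
Lemma C4_cycle_edges (c : seq C4) :
  graph_cycle c -> cycle_edges c = [set [set x; ordS x] | x : C4].
Proof.
move=> gc; have /and3P[_ uc _] := gc; apply/setP=> E; apply/imsetP/imsetP.
  case=> x xc ->; have := set21 (next c x) (prev c x).
  rewrite (C4_cycle_next gc xc) !inE => /orP[] /eqP->; first by exists x.
  by exists (ord_pred x); rewrite // ord_predK setUC.
case=> x _ ->; have xc := C4_cycle_full x gc.
have := set21 (ordS x) (ord_pred x).
rewrite -(C4_cycle_next gc xc) !inE => /orP[] /eqP->; first by exists x.
by exists (prev c x); rewrite ?mem_prev // next_prev // setUC.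
Qed.

Lemma C4_connected : connected C4.
Proof.
have c01 y : connect (@adj C4) c4_0 y.
  have C i : connect (@adj C4) i (ordS i) by apply: connect1; rewrite C4_adjE eqxx.
  have: y \in [:: c4_0; ordS c4_0; ordS (ordS c4_0); ordS (ordS (ordS c4_0))].
    by case: y => [[|[|[|[|]]]] ?].
  rewrite !inE => /or4P[] /eqP-> //;
    by do ?[apply: connect_trans (C _)]; rewrite ?connect0.
move=> x y; apply: connect_trans (c01 y).
by rewrite (sym_connect_sym (@adj_sym C4)).
Qed.

Lemma unicyclic4_C4 : unicyclic4 4 C4.
Proof.
split; first exact: card_ord.
  split; first exact: C4_connected.
  pose c := [:: c4_0; c4_1; c4_2; ordS c4_2] : seq C4.
  have gc: graph_cycle c by [].
  by exists c => // c' gc'; rewrite !C4_cycle_edges.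
move=> c gc; have /and3P[_ uc _] := gc.
rewrite -(card_uniqP uc) -[RHS](card_ord 4); apply: eq_card => x.
by rewrite C4_cycle_full.
Qed.

(** * Embeddings and the classification of graphs with a vertex of high degree *)

(** Embedding as an induced subgraph: non-edges are kept, so equal vertex counts yield an
    isomorphism. *)
Definition embedding (H G : sgraph) (f : H -> G) : Prop :=
  injective f /\ forall x y, adj (f x) (f y) = adj x y.

Lemma embedding_iso (H G : sgraph) (f : H -> G) :
  embedding f -> #|G| <= #|H| -> isomorphic G H.
Proof.
case=> f_inj f_adj leGH; have [g fK gK] := inj_card_bij f_inj leGH.
by exists g => [|x y]; [exists f | rewrite -f_adj !gK].
Qed.

Definition leaf_map (H G : sgraph) (v : H) (k : nat) (f : H -> G)
    (h : 'I_k -> G) (x : add_leaves v k) : G :=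
  match x with inl y => f y | inr i => h i end.

Lemma leaf_map_embedding (H G : sgraph) (v : H) (k : nat) (f : H -> G)
    (h : 'I_k -> G) :
    embedding f -> injective h -> (forall i x, f x != h i) ->
    (forall i x, adj (h i) (f x) = (x == v)) ->
    (forall i j, ~~ adj (h i) (h j)) ->
  embedding (leaf_map f h : add_leaves v k -> G).
Proof.
move=> [f_inj f_adj] h_inj neq_fh hf_adj hh_adj; split.
- move=> [x|i] [y|j] /= E.
  + by rewrite (f_inj _ _ E).
  + by have := neq_fh j x; rewrite E eqxx.
  + by have := neq_fh i y; rewrite E eqxx.
  + by rewrite (h_inj _ _ E).
- by move=> [x|i] [y|j] //=; [rewrite adj_sym hf_adj | apply: negbTE].
Qed.

Lemma C4_embedding (G : sgraph) (v a b d : G) :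
    graph_cycle [:: v; a; b; d] -> ~~ adj v b -> ~~ adj a d ->
  embedding (fun i : C4 => nth v [:: v; a; b; d] i).
Proof.
move=> /and3P[_ uc /and5P[va ab bd dv _]] /negPf vb /negPf ad; split.
  move=> i j /eqP; rewrite nth_uniq // => /eqP; exact: val_inj.
have [av ba db vd] : [/\ adj a v, adj b a, adj d b & adj v d].
  by split; rewrite adj_sym.
have [bv da] : adj b v = false /\ adj d a = false by split; rewrite adj_sym.
case=> [[|[|[|[|]]]] ?] // [[|[|[|[|]]]] ?] //=; by rewrite ?adj_irrefl.
Qed.

(** The prescribed value at [i] serves [G41'], where one particular leaf carries the pendant; a
    transposition corrects the standard enumeration. *)
Lemma enum_from (T : finType) (A : {set T}) (k : nat) (i : 'I_k) (q : T) :
    #|A| = k -> q \in A ->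
  exists h : 'I_k -> T, [/\ injective h, forall j, h j \in A & h i = q].
Proof.
move=> cardA; case: k / cardA i => i qA.
exists (fun j => enum_val (tperm i (enum_rank_in qA q) j)); split.
- by move=> j j' /enum_val_inj /perm_inj.
- by move=> j; exact: enum_valP.
- by rewrite tpermL enum_rankK_in.
Qed.

(** The degree 2 of [x] is used up by its two cycle neighbours; an outside neighbour would be a
    third. *)
Lemma excess0_closed (G : sgraph) (c : seq G) (x y : G) :
    unicyclic G -> graph_cycle c -> x \in c -> excess c x = 0 -> adj x y ->
  y \in c.
Proof.
move=> [conn_G _] gc xc ex xy; apply: contraT => yNc.
have: deg x <= 2 by rewrite (deg_excess x conn_G gc) xc ex.
have [xn xp np] := graph_cycle_nbrs gc xc.
rewrite leqNgt => /negP[]; apply/card_gt2P.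
exists (next c x), (prev c x), y; rewrite !inE; split; split=> //.
  by apply: contraNneq yNc => <-; rewrite mem_prev.
by apply: contraNneq yNc => ->; rewrite mem_next.
Qed.

(** Off the cycle [v] would use the whole excess budget. All cycle vertices would then have excess
    0, so [c] would be closed under adjacency, against connectedness. *)
Lemma high_degree_on_cycle (G : sgraph) (c : seq G) (v : G) :
    unicyclic G -> graph_cycle c -> #|G| - size c < deg v -> v \in c.
Proof.
move=> uG gc big_v; have [conn_G _] := uG; apply: contraT => vNc.
have := deg_excess v conn_G gc; rewrite (negPf vNc) => deg_v.
have [x xc]: exists x, x \in c.
  by case: (c) (and3P gc) => [[]//|x s _]; exists x; rewrite mem_head.
suff c_closed: closed (@adj G) (mem c).
  by have := closed_connect c_closed (conn_G x v); rewrite /= xc (negPf vNc).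
apply: (intro_closed (sym_connect_sym (@adj_sym G))) => y z yz yc.
apply: (excess0_closed uG gc yc _ yz).
have: v != y by apply: contraNneq vNc => ->.
by move/(excess_budget2 uG gc); lia.
Qed.

Lemma high_degree_classification (n : nat) (hn : 6 <= n) (G : sgraph) (v : G) :
    unicyclic4 n G -> n - 4 < deg v ->
  [\/ isomorphic G (G41 n), isomorphic G (G42 n), isomorphic G (G43 n)
    | isomorphic G (G41' hn)].
Proof.
move=> [cardG uG size4] big_v; have [conn_G [c0 gc0 _]] := uG.
have [a [b [d gc]]]: exists a b d, graph_cycle [:: v; a; b; d].
  have vc0: v \in c0.
    by apply: (high_degree_on_cycle uG gc0); rewrite cardG (size4 _ gc0).
  have [i s def_c0] := rot_to vc0.
  have gc: graph_cycle (v :: s).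
    by rewrite -def_c0 /graph_cycle size_rot rot_uniq rot_cycle.
  have := size4 _ gc; case: s gc {def_c0} => [|a [|b [|d [|]]]] // gc _.
  by exists a, b, d.
set c := [:: v; a; b; d] in gc; have szc: size c = 4 by [].
have /and3P[_ uc /and5P[va ab bd dv _]] := gc.
have [vd av] : adj v d /\ adj a v by split; rewrite adj_sym.
have neq_adj (x y : G) : adj x y -> x != y.
  by apply: contraTneq => ->; rewrite adj_irrefl.
have no_triangle (x y z : G) : adj x y -> adj y z -> ~~ adj z x.
  move=> xy yz; apply/negP=> zx.
  suff gt: graph_cycle [:: x; y; z] by have := size4 _ gt.
  rewrite /graph_cycle /= !inE negb_or xy yz zx !neq_adj //.
  by rewrite adj_sym.
(* A chord would create a triangle, but all cycles have length 4; hence the 4-cycle is induced. *)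
have vb: ~~ adj v b by rewrite adj_sym; apply: no_triangle ab.
have ad: ~~ adj a d by rewrite adj_sym; apply: no_triangle bd.
have f_emb := C4_embedding gc vb ad; set f := (fun _ => _) in f_emb.
(* The reversed listing reduces the case [q = d] below to [q = a]. *)
have gc': graph_cycle [:: v; d; b; a].
  move: uc; rewrite -(rev_uniq c) -(rot_uniq 3) => uc'.
  apply/and3P; split=> //; apply/and5P; split=> //; by rewrite adj_sym.
have f'_emb: embedding (fun i : C4 => nth v [:: v; d; b; a] i).
  by apply: C4_embedding; rewrite // adj_sym.
set f' := (fun _ => _) in f'_emb.
have f_c x : f x \in c by case: x => [[|[|[|[|]]]] ?]; rewrite // !inE eqxx ?orbT.
have f'_c x : f' x \in c by case: x => [[|[|[|[|]]]] ?]; rewrite // !inE eqxx ?orbT.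
pose A := [set y | adj v y] :\: [set a; d].
have cardA: #|A| = deg v - 2.
  rewrite cardsD (setIidPr _); last by apply/subsetP=> y; rewrite !inE => /orP[] /eqP->.
  by rewrite cards2; move: uc => /= /and4P[_]; rewrite !inE !negb_or => /andP[_ ->].
have Av y : y \in A -> adj y v by rewrite !inE adj_sym => /andP[].
have AC y : y \in A -> y \notin c.
  rewrite !inE !negb_or => /andP[/andP[-> ->] vy]; rewrite eq_sym neq_adj //=.
  by rewrite andbT; apply: contraNneq vb => <-.
have deg_v: deg v = 2 + excess c v by rewrite (deg_excess v conn_G gc) mem_head.
have le_ev: excess c v <= n - 4.
  have := unicyclic_sum_excess uG gc; rewrite cardG szc (bigD1 v) //=.
  exact: leq_trans (leq_addr _ _).
have budget2 x : v != x -> excess c v + excess c x <= n - 4.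
  by move/(excess_budget2 uG gc); rewrite cardG.
have budget3 x y : v != x -> v != y -> x != y ->
    excess c v + excess c x + excess c y <= n - 4.
  by move=> vx vy xy; rewrite -cardG -szc; exact: excess_budget.
have leaf_adj y p : y \notin c -> excess c y = 0 -> adj y p ->
    forall z, adj y z = (z == p).
  move=> yNc ey yp; apply: deg1_adj yp.
  by rewrite (deg_excess y conn_G gc) (negPf yNc) ey.
have adj_v y : y \in A -> v != y by move/Av; rewrite adj_sym; exact: neq_adj.
(* Since [2 + excess c v > n - 4], at most one unit of the budget [n - 4] is left. If none is, every
   member of [A] is a leaf at [v], which gives [G41]. *)
have [ev|ev]: excess c v = n - 4 \/ excess c v = n - 5.
  by clear - deg_v le_ev big_v hn; lia.
  have cardA': #|A| = n - 4 by rewrite cardA deg_v addKn.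
  have n4: 0 < n - 4 by rewrite subn_gt0 (leq_trans _ hn).
  have [q qA]: exists q, q \in A by apply/card_gt0P; rewrite cardA'.
  have [h [h_inj hA _]] := enum_from (Ordinal n4) cardA' qA.
  have hv i z : adj (h i) z = (z == v).
    apply: leaf_adj; [exact: AC | | exact: Av].
    have := budget2 _ (adj_v _ (hA i)); rewrite ev => le_e.
    by clear - le_e; lia.
  constructor 1; apply: (@embedding_iso _ _ (leaf_map f h)); last first.
    by rewrite card_add_leaves card_ord cardG subnKC // (leq_trans _ hn).
  apply: leaf_map_embedding => //.
  - by move=> i x; apply: contraNneq (AC _ (hA i)) => <-.
  - by move=> i x; rewrite hv (inj_eq f_emb.1 x c4_0).
  - by move=> i j; rewrite hv eq_sym adj_v.
have cardA': #|A| = n - 5 by rewrite cardA deg_v addKn.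
(* The cycle and [A] account for [4 + (n - 5)] vertices, so one is missing. *)
have [w def_w]: exists w, ~: ([set x in c] :|: A) = [set w].
  apply/cards1P; rewrite cardsCs setCK cardsU cardG cardA'.
  rewrite (_ : _ :&: A = set0); last first.
    apply/setP=> y; rewrite in_set0 in_setI in_set; apply/negP => /andP[yc /AC].
    by rewrite yc.
  by rewrite cards0 cardsE (card_uniqP uc) szc; apply/eqP; clear - hn; lia.
have wP y : (y == w) = (y \notin c) && (y \notin A).
  by rewrite -in_set1 -def_w in_setC in_setU in_set negb_or.
have /andP[wNc wNA]: (w \notin c) && (w \notin A) by rewrite -wP.
have /card_gt0P[q]: 0 < deg w.
  by rewrite (deg_excess w conn_G gc).
rewrite in_set => wq.
have wNv: ~~ adj w v.
  apply: contra wNA => wv; rewrite !inE adj_sym wv andbT.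
  by apply: contra wNc; rewrite !inE => /orP[] /eqP->; rewrite eqxx ?orbT.
have qv: v != q by apply: contraNneq wNv => ->.
have neq_vw: v != w by apply: contraNneq wNc => <-; rewrite mem_head.
have neq_qw: q != w by rewrite eq_sym neq_adj.
(* On the cycle, excess 0 would force [w] into [c]; off it, [q] lies in [A] and has both [v] and [w]
   as neighbours. *)
have eq_pos: 0 < excess c q.
  have [qc|qNc] := boolP (q \in c).
    rewrite lt0n; apply: contra wNc => /eqP eq0.
    by apply: (excess0_closed uG gc qc eq0); rewrite adj_sym.
  have qA: q \in A by apply: contraT => qNA; rewrite wP qNc qNA in neq_qw.
  have: 1 < deg q.
    by apply/card_gt1P; exists v, w; rewrite !inE Av // adj_sym.
  by rewrite (deg_excess q conn_G gc) (negPf qNc).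
have adj_w z : adj w z = (z == q).
  apply: leaf_adj => //; have := budget3 _ _ qv neq_vw neq_qw => le_e.
  by clear - le_e ev eq_pos hn; lia.
(* The last unit belongs to [q]. Other members of [A] are leaves, and if [q] is in [A] its degree 2
   is exhausted by [v] and [w]. *)
have adj_A y z : y \in A -> z != w -> adj y z = (z == v).
  move=> yA zw; have [eq_yq|neq_yq] := eqVneq y q; last first.
    apply: leaf_adj; [exact: AC | | exact: Av].
    rewrite eq_sym in neq_yq; have le_e := budget3 _ _ qv (adj_v _ yA) neq_yq.
    by clear - le_e ev eq_pos hn; lia.
  apply/idP/eqP=> [yz|->]; last exact: Av.
  apply: contraTeq isT => neq_zv.
  have: 2 < deg y.
    apply/card_gt2P; exists v, w, z; rewrite !inE; split; split=> //.
    - exact: Av.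
    - by rewrite eq_yq adj_sym.
    - by rewrite eq_sym.
  rewrite (deg_excess y conn_G gc) (negPf (AC _ yA)) eq_yq.
  by have le_e := budget2 _ qv; clear - le_e ev hn; lia.
(* Common end of the remaining cases: [x0] is the model vertex carrying the last pendant and is sent
   to [q]; [g] lists the cycle in either direction. *)
have iso k (g : C4 -> G) (h : 'I_k -> G) (x0 : add_leaves c4_0 k) :
    embedding g -> g c4_0 = v -> (forall x, g x \in c) -> injective h ->
    (forall i, h i \in A) -> k = n - 5 -> leaf_map g h x0 = q ->
  isomorphic G (@add_leaves (add_leaves c4_0 k) x0 1).
  move=> g_emb gv g_c h_inj hA def_k def_q.
  have gw x : g x != w by apply: contraNneq wNc => <-.
  have hw i : h i != w by apply: contraNneq wNA => <-.
  have gh_emb: embedding (leaf_map g h : add_leaves c4_0 k -> G).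
    apply: leaf_map_embedding => //.
    - by move=> i x; apply: contraNneq (AC _ (hA i)) => <-.
    - by move=> i x; rewrite adj_A // -gv (inj_eq g_emb.1 x c4_0).
    - by move=> i j; rewrite adj_A // eq_sym adj_v.
  apply: (@embedding_iso _ _ (leaf_map (leaf_map g h) (fun=> w))); last first.
    by rewrite !card_add_leaves card_ord cardG def_k; clear - hn; lia.
  apply: leaf_map_embedding => //.
  - by move=> i j _; rewrite !ord1.
  - by move=> _ [x|i] /=.
  - by move=> _ x; rewrite adj_w -def_q (inj_eq gh_emb.1 x x0).
  - by move=> _ _; rewrite adj_irrefl.
have n5: 0 < n - 5 by rewrite subn_gt0.
have [r rA]: exists r, r \in A by apply/card_gt0P; rewrite cardA'.
have [h [h_inj hA _]] := enum_from (Ordinal n5) cardA' rA.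
have [qA|qNA] := boolP (q \in A).
  (* The leaves of [G41 n.-1] are indexed by ['I_(n.-1 - 4)], so [A] must be counted in that
     form. *)
  have k_eq: n.-1 - 4 = n - 5 by rewrite -subn1 -subnDA.
  have cardA4: #|A| = n.-1 - 4 by rewrite k_eq.
  constructor 4.
  have [h' [h'_inj h'A h'q]] := enum_from (Ordinal (G41_pred_has_leaf hn)) cardA4 qA.
  exact: (iso _ f h').
have: q \in c by apply: contraT => qNc; rewrite wP qNc qNA in neq_qw.
rewrite !inE eq_sym (negPf qv) /= => /or3P[] /eqP def_q.
- by constructor 2; apply: (iso _ f h).
- by constructor 3; apply: (iso _ f h).
- by constructor 2; apply: (iso _ f' h).
Qed.

Theorem theorem11 (n : nat) (hn : 6 <= n) :
  [/\ unicyclic4 n (G41 n), unicyclic4 n (G42 n),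
      unicyclic4 n (G43 n) & unicyclic4 n (G41' hn)] /\
  [/\ F_index (G41 n) > F_index (G42 n),
      F_index (G42 n) = F_index (G43 n) &
      F_index (G43 n) > F_index (G41' hn)] /\
  (forall G : sgraph,
     unicyclic4 n G ->
     ~ isomorphic G (G41 n) -> ~ isomorphic G (G42 n) ->
     ~ isomorphic G (G43 n) -> ~ isomorphic G (G41' hn) ->
     F_index G < F_index (G41' hn)).
Proof.
have le4n: 4 <= n by lia.
have le5n: 5 <= n by lia.
have F42 : F_index (G42 n) = (n - 3) ^ 3 + n + 39 by exact: F_index_C4_leaves_pendant.
have F43 : F_index (G43 n) = (n - 3) ^ 3 + n + 39 by exact: F_index_C4_leaves_pendant.
split; [|split].
- have leaf m k (G : sgraph) (x : G) :
      unicyclic4 m G -> m + k = n -> unicyclic4 n (add_leaves x k).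
    by move=> uG <-; exact: unicyclic4_add_leaves.
  have u5 : unicyclic4 n.-1 (@add_leaves C4 c4_0 (n - 5)).
    rewrite (_ : n.-1 = 4 + (n - 5)); last by lia.
    exact: unicyclic4_add_leaves unicyclic4_C4.
  split.
  + by apply: leaf unicyclic4_C4 _; lia.
  + by apply: leaf u5 _; lia.
  + by apply: leaf u5 _; lia.
  + have u4 : unicyclic4 n.-1 (G41 n.-1).
      rewrite {1}(_ : n.-1 = 4 + (n.-1 - 4)); last by lia.
      exact: unicyclic4_add_leaves unicyclic4_C4.
    by apply: leaf u4 _; lia.
- rewrite F42 F43 F_index_G41 // F_index_G41'; split=> //; last by lia.
  have ->: n - 2 = (n - 3).+1 by lia.
  (* With [m = n - 3] the gap is [3 * m ^ 2 + 3 * m - 18], which vanishes at [m = 2] and is positive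
     from [m = 3] on. *)
  have: 3 <= n - 3 by lia.
  by move: (n - 3) => m; rewrite !expnS expn0; nia.
- move=> G uG n41 n42 n43 n41'; rewrite F_index_G41'.
  have [cardG [conn_G [c gc edges_c]] size4] := uG.
  apply: (small_degrees_F_index cardG _ gc (size4 _ gc) hn).
    by split=> //; exists c.
  move=> v; rewrite leqNgt; apply/negP=> /(high_degree_classification hn uG).
  by case.
Qed.
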